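(* Let $F$ be a field of characteristic not two and let $E$ be a finite-dimensional vector space over $F$ with an arbitrary symmetric bilinear form $(U,V)\mapsto U\cdot V$. Let $\overline{UVW}$ be a non-null triangle in $E$ with quadrances $Q_W=Q(U,V)$, $Q_U=Q(V,W)$, and spreads $s_U=s(UV,UW)$, $s_W=s(WU,WV)$. If $s_W=1$, then $$s_U=\frac{Q_U}{Q_W}.$$
   Context: Elements of $E$ are called points or vectors. The quadrance between points $U$ and $V$ is $Q(U,V)=(V-U)\cdot(V-U)$. The line $UV$ through distinct points $U,V$ is null if $Q(U,V)=0$, and non-null otherwise. A triangle $\overline{UVW}$ is a set of three distinct non-collinear points; it is non-null when each of the lines $UV$, $VW$, $UW$ is non-null. The spread between non-null lines $UW$ and $VZ$ is $$s(UW,VZ)=1-\frac{\left((W-U)\cdot(Z-V)\right)^2}{Q(U,W)\,Q(V,Z)},$$ which depends only on the two lines. The bilinear form is not assumed non-degenerate. *)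

(* Defs.v *)
From mathcomp Require Import all_boot all_order all_algebra.
Set Implicit Arguments.
Unset Strict Implicit.
Unset Printing Implicit Defensive.
Import GRing.Theory.
Local Open Scope ring_scope.

Section AffineGeometry.
Variables (F : fieldType) (E : vectType F).

Definition line (A B : E) : {pred E} := [pred X | X - A \in <[B - A]>%VS].

Definition collinear (U V W : E) : Prop :=
  exists A B : E,
    A != B /\ [/\ U \in line A B, V \in line A B & W \in line A B].

Definition triangle (U V W : E) : Prop :=
  [/\ U != V, V != W, U != W & ~ collinear U V W].

End AffineGeometry.

Section MetricalGeometry.
Variables (F : fieldType) (E : vectType F) (form : {symmetric E}).

Definition quadrance (U V : E) : F := form (V - U) (V - U).

(* A line is given by two distinct points on it; distinctness is a hypothesis
   wherever this is used. *)
Definition null_line (U V : E) : bool := quadrance U V == 0.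

Definition nonnull_triangle (U V W : E) : Prop :=
  triangle U V W /\
  [/\ ~~ null_line U V, ~~ null_line V W & ~~ null_line U W].

(* The spread between the lines UW and VZ, meaningful when both are
   non-null. *)
Definition spread (U W V Z : E) : F :=
  1 - form (W - U) (Z - V) ^+ 2 / (quadrance U W * quadrance V Z).

End MetricalGeometry.

(* Main.v *)
Require Import Defs.
From mathcomp Require Import all_boot all_order all_algebra.
From mathcomp Require Import ring.
Import GRing.Theory.
Local Open Scope ring_scope.

(** A spread of 1 at [W] says, by clearing the nonzero quadrances in its
    definition, that the sides [WU] and [WV] are orthogonal.  Expanding along
    [V - U = (V - W) - (U - W)], where the cross terms vanish, then gives two
    facts: Pythagoras' theorem [Q_W = Q_V + Q_U] ([pythagoras]), and the
    equality of [(V - U) . (W - U)] with [Q_V] ([form_hypotenuse_leg]), the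
    foot of the perpendicular from [V] to [UW] being [W].  Hence
    [s_U = 1 - Q_V ^ 2 / (Q_W Q_V) = (Q_W - Q_V) / Q_W = Q_U / Q_W]. *)

Section RightTriangle.
Local Set Implicit Arguments.
Local Unset Strict Implicit.
Variables (F : fieldType) (E : vectType F) (form : {symmetric E}).
Implicit Types A B C : E.

Lemma form_sym A B : form A B = form B A.
Proof. by rewrite hermC expr0 mul1r. Qed.

Lemma quadrance_sym A B : quadrance form A B = quadrance form B A.
Proof. by rewrite /quadrance -opprB linearNl linearNr opprK. Qed.

(** Non-nullity is essential here: division by zero yields zero, so that the
    spread formula would also evaluate to 1 along a null line. *)
Lemma spread_eq1_orthogonal A B C :
    ~~ null_line form C A -> ~~ null_line form C B ->
  spread form C A C B = 1 -> form (A - C) (B - C) = 0.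
Proof.
rewrite /null_line /spread => nA nB /eqP.
rewrite -subr_eq0 addrAC subrr add0r oppr_eq0.
rewrite mulf_eq0 expf_eq0 invr_eq0 mulf_eq0 (negPf nA) (negPf nB) !orbF /=.
by move/eqP.
Qed.

Lemma pythagoras A B C : form (A - C) (B - C) = 0 ->
  quadrance form A B = quadrance form C A + quadrance form C B.
Proof.
rewrite /quadrance => orthC.
have -> : B - A = (B - C) - (A - C) by rewrite opprB addrA subrK.
move: (A - C) (B - C) orthC => a b orth_ab.
rewrite linearBl !linearBr /= (form_sym b a) orth_ab.
by rewrite sub0r subr0 opprK addrC.
Qed.

(** The component of [B - A] along [C - A] is [C - A] itself, since the
    remainder [B - C] is orthogonal to it. *)
Lemma form_hypotenuse_leg A B C : form (A - C) (B - C) = 0 ->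
  form (B - A) (C - A) = quadrance form C A.
Proof.
rewrite /quadrance => orthC.
have -> : B - A = (B - C) - (A - C) by rewrite opprB addrA subrK.
rewrite -[C - A]opprB.
move: (A - C) (B - C) orthC => a b orth_ab.
rewrite linearBl !linearNr /= (form_sym b a) orth_ab.
by rewrite oppr0 sub0r opprK.
Qed.

End RightTriangle.

Theorem theorem4 (F : fieldType) (hF : 2%N \notin [pchar F])
    (E : vectType F) (form : {symmetric E}) (U V W : E)
    (hUVW : nonnull_triangle form U V W)
    (hW : spread form W U W V = 1) :
  spread form U V U W = quadrance form V W / quadrance form U V.
Proof.
case: hUVW => _ []; rewrite /null_line => nUV nVW nUW.
rewrite quadrance_sym in nVW; rewrite quadrance_sym in nUW.
have orthW := spread_eq1_orthogonal nUW nVW hW.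
rewrite /spread (form_hypotenuse_leg orthW).
rewrite (quadrance_sym _ U W) (quadrance_sym _ V W).
rewrite (pythagoras orthW) in nUV *.
(* Kept as atoms: the quadrances would otherwise be expanded additively by
   the field normalization. *)
move: (quadrance form W U) (quadrance form W V) nUW nUV => p q p_neq0 pq_neq0.
by field; rewrite pq_neq0.
Qed.
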